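(* Let $F$ be a (commutative) field of characteristic $p>0$, let $m\geq 1$ and $t\geq 2$ be integers, and let $\sum_{\lambda\in\mathbb{N}} t_\lambda p^\lambda$ (with $t_\lambda\in\{0,1,\ldots,p-1\}$, only finitely many non-zero) be the representation of $t$ in base $p$. If $\#F\geq t$, then the nucleus of a Veronese variety $\mathcal{V}_m^t$ over $F$ has projective dimension $$\binom{m+t}{t}-\prod_{\lambda\in\mathbb{N}}\binom{m+t_\lambda}{t_\lambda}-1 .$$
   Context: $\mathbb{N}=\{0,1,2,\ldots\}$. Let $\mathbf{X}$ be an $(m+1)$-dimensional vector space over $F$ with dual space $\mathbf{X}^*$, and let $S^t\mathbf{X}^*$ be the $t$-th symmetric power of $\mathbf{X}^*$. Let $\mathbf{Y}$ be an $F$-vector space such that $(S^t\mathbf{X}^*,\mathbf{Y})$ is a dual pair with a non-degenerate bilinear pairing $\langle\,,\,\rangle: S^t\mathbf{X}^*\times\mathbf{Y}\to F$ (so $\dim\mathbf{Y}=\binom{m+t}{t}$). For each $\mathbf{x}\in\mathbf{X}$ let $g(\mathbf{x})\in\mathbf{Y}$ be the unique vector with $\langle \mathbf{a}_1^*\cdot\mathbf{a}_2^*\cdots\mathbf{a}_t^*,\,g(\mathbf{x})\rangle=\mathbf{a}_1^*(\mathbf{x})\,\mathbf{a}_2^*(\mathbf{x})\cdots\mathbf{a}_t^*(\mathbf{x})$ for all $\mathbf{a}_1^*,\ldots,\mathbf{a}_t^*\in\mathbf{X}^*$. Write $\mathcal{P}(\mathbf{V})$ for the projective space on a vector space $\mathbf{V}$,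 whose points are the one-dimensional subspaces of $\mathbf{V}$. The Veronese mapping is $\gamma:\mathcal{P}(\mathbf{X})\to\mathcal{P}(\mathbf{Y})$, $F\mathbf{x}\mapsto F g(\mathbf{x})$, and its image is the Veronese variety $\mathcal{V}_m^t$. For each $\mathbf{a}^*\in\mathbf{X}^*\setminus\{0\}$, the hyperplane $\{\mathbf{y}\in\mathbf{Y}\mid\langle(\mathbf{a}^* )^t,\mathbf{y}\rangle=0\}$ of $\mathbf{Y}$, regarded as a hyperplane of $\mathcal{P}(\mathbf{Y})$, is the osculating hyperplane of $\mathcal{V}_m^t$ along the subvariety $\gamma(\mathcal{P}(\ker\mathbf{a}^* ))$; here $(\mathbf{a}^* )^t\in S^t\mathbf{X}^*$ is the $t$-th symmetric power of $\mathbf{a}^*$. These are all the osculating hyperplanes of $\mathcal{V}_m^t$. The nucleus of $\mathcal{V}_m^t$ is the intersection of all its osculating hyperplanes; it is a projective subspace of $\mathcal{P}(\mathbf{Y})$. The projective dimension of a projective subspace is the dimension of the corresponding vector subspace minus one (the empty subspace has projective dimension $-1$). *)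

(* Defs.v *)
From HB Require Import structures.
From mathcomp Require Import all_boot all_order all_fingroup all_algebra.
From Stdlib Require Import Classical ClassicalEpsilon.

Set Implicit Arguments.
Unset Strict Implicit.
Unset Printing Implicit Defensive.

Import GRing.Theory.
Local Open Scope ring_scope.

Definition dual (F : fieldType) (X : vectType F) : vectType F := 'Hom(X, F^o).

Definition ffun_upd (I : finType) (T : Type) (a : {ffun I -> T}) (i : I) (u : T)
  : {ffun I -> T} := [ffun j => if j == i then u else a j].

Definition multilinear (F : fieldType) (t : nat) (U W : lmodType F)
    (f : {ffun 'I_t -> U} -> W) : Prop :=
  forall (a : {ffun 'I_t -> U}) (i : 'I_t) (c : F) (u v : U),
    f (ffun_upd a i (c *: u + v)) =
      c *: f (ffun_upd a i u) + f (ffun_upd a i v).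

Definition symmetric_map (t : nat) (U W : Type) (f : {ffun 'I_t -> U} -> W)
    : Prop :=
  forall (s : 'S_t) (a : {ffun 'I_t -> U}), f [ffun i => a (s i)] = f a.

(* (S, mul) is the t-th symmetric power of U, with mul (a_1, ..., a_t) the
   product a_1 ... a_t: mul is the universal symmetric t-linear map on U.
   This determines (S, mul) up to a unique isomorphism. *)
Definition is_sym_power (F : fieldType) (t : nat) (U S : lmodType F)
    (mul : {ffun 'I_t -> U} -> S) : Prop :=
  [/\ multilinear mul,
      symmetric_map mul
    & forall (W : lmodType F) (f : {ffun 'I_t -> U} -> W),
        multilinear f -> symmetric_map f ->
        exists phi : {linear S -> W},
          (forall a, phi (mul a) = f a) /\
          (forall psi : {linear S -> W},
             (forall a, psi (mul a) = f a) -> psi =1 phi)].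

Definition nondegenerate_pairing (F : fieldType) (S Y : lmodType F)
    (B : S -> Y -> F) : Prop :=
  (forall s, (forall y, B s y = 0) -> s = 0) /\
  (forall y, (forall s, B s y = 0) -> y = 0).

(* The data defining a Veronese variety V_m^t, for \dim X = m + 1. *)
Record veronese (F : fieldType) (X : vectType F) (t : nat) : Type := Veronese {
  ver_sym : vectType F;
  ver_mul : {ffun 'I_t -> dual X} -> ver_sym;
  ver_symP : is_sym_power ver_mul;
  ver_space : vectType F;
  ver_pair : {bilinear ver_sym -> ver_space -> F^o};
  ver_pairP : nondegenerate_pairing ver_pair;
  ver_g : X -> ver_space;
  ver_gP : forall (a : {ffun 'I_t -> dual X}) (x : X),
      ver_pair (ver_mul a) (ver_g x) = \prod_(i < t) (a i x : F)
}.

Section Veronese.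
Variables (F : fieldType) (X : vectType F) (t : nat) (V : veronese X t).

(* A point of a projective space is represented by the line it is, as a vector
   subspace; this is the image under F x |-> F (g x) of the projective space
   on U, and veronese_image fullv is the Veronese variety. *)
Definition veronese_image (U : {vspace X}) (L : {vspace ver_space V}) : Prop :=
  exists x : X, [/\ x \in U, x != 0 & L = <[ver_g V x]>%VS].

Definition sym_pow (a : dual X) : ver_sym V := ver_mul V [ffun _ => a].

Definition osculating_hyperplane (a : dual X) : {vspace ver_space V} :=
  lker (linfun (ver_pair V (sym_pow a))).

Definition osculates_along (H : {vspace ver_space V})
    (Z : {vspace ver_space V} -> Prop) : Prop :=
  exists a : dual X,
    [/\ a != 0, H = osculating_hyperplane a & Z = veronese_image (lker a)].

Definition osculating (H : {vspace ver_space V}) : Prop :=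
  exists Z, osculates_along H Z.

End Veronese.

Lemma mem_osculating_hyperplane (F : fieldType) (X : vectType F) (t : nat)
    (V : veronese X t) (a : dual X) (y : ver_space V) :
  (y \in osculating_hyperplane V a) = (ver_pair V (sym_pow V a) y == 0).
Proof. by rewrite memv_ker lfunE. Qed.

Lemma bigcapv_ex (F : fieldType) (Y : vectType F) (P : {vspace Y} -> Prop) :
  exists N : {vspace Y}, forall y, y \in N <-> (forall H, P H -> y \in H).
Proof.
suff main n (U : {vspace Y}) : (\dim U <= n)%N ->
    exists N : {vspace Y}, forall y,
      y \in N <-> (y \in U /\ forall H, P H -> y \in H).
  have [N NP] := main _ fullv (leqnn _).
  by exists N => y; split=> [/NP[] //|h]; apply/NP; split=> //; exact: memvf.
elim: n U => [|n IHn] U leUn.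
  exists U => y; split=> [yU|[]//]; split=> // H _.
  move: leUn yU; rewrite leqn0 dimv_eq0 => /eqP->.
  by rewrite memv0 => /eqP->; exact: mem0v.
have [[H [PH nUH]]|nex] := classic (exists H, P H /\ ~ (U <= H)%VS); last first.
  exists U => y; split=> [yU|[]//]; split=> // H PH.
  suff /subvP : (U <= H)%VS by apply.
  by apply: NNPP => nUH; apply: nex; exists H.
have ltU : (\dim (U :&: H) < \dim U)%N.
  rewrite ltn_neqAle dimvS ?capvSl // andbT.
  apply/negP => /eqP eqd; apply: nUH.
  have /eqP <- : (U :&: H == U)%VS by rewrite eqEdim capvSl eqd leqnn.
  exact: capvSr.
have [N NP] := IHn (U :&: H)%VS (leq_trans ltU leUn).
exists N => y; rewrite NP memv_cap; split=> [[/andP[]]//|[yU yH]].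
by rewrite yU yH.
Qed.

(* The intersection of a (possibly infinite) family of subspaces. *)
Definition bigcapv (F : fieldType) (Y : vectType F) (P : {vspace Y} -> Prop)
    : {vspace Y} :=
  proj1_sig (constructive_indefinite_description _ (bigcapv_ex P)).

Lemma bigcapvP (F : fieldType) (Y : vectType F) (P : {vspace Y} -> Prop) y :
  y \in bigcapv P <-> (forall H, P H -> y \in H).
Proof.
exact: (proj2_sig (constructive_indefinite_description _ (bigcapv_ex P))).
Qed.

Definition nucleus (F : fieldType) (X : vectType F) (t : nat)
    (V : veronese X t) : {vspace ver_space V} := bigcapv (@osculating F X t V).

Definition projdim (F : fieldType) (Y : vectType F) (U : {vspace Y}) : int :=
  (\dim U)%:Z - 1.

(* #F >= n, for a possibly infinite F *)
Definition card_ge (T : eqType) (n : nat) : Prop :=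
  exists s : n.-tuple T, uniq s.

(* Main.v *)
Require Import Defs.
From HB Require Import structures.
From mathcomp Require Import all_boot all_order all_fingroup all_algebra.
From mathcomp.multinomials Require Import mpoly.

Set Implicit Arguments.
Unset Strict Implicit.
Unset Printing Implicit Defensive.

Import GRing.Theory.
Local Open Scope ring_scope.

(** The nucleus is the annihilator in Y of the span W of all powers a^t inside
the symmetric power S of the dual of X. The pairing is non-degenerate, so the
vector dimension of the nucleus is dim S - dim W ([dim_orthogonal]), and
everything takes place in S.

Fix a basis b_0, ..., b_m of the dual space. By the universal property,
S is identified with the homogeneous polynomials of degree t in m + 1
variables, a product of vectors going to the product of the corresponding
linear forms ([sym_power_mpoly]). Hence the monomials in the b_j of degree t
form a basis of S, and dim S = 'C(m + t, t). If a has coordinates alpha, then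
a^t is the sum over the exponents e of (c_e * alpha^e) times the monomial e,
where the multinomial coefficient c_e is the coefficient at e of
(X_0 + ... + X_m)^t. So W lies in the span of the monomials with c_e <> 0 in F.

Conversely each of these monomials lies in W, and this is where #F >= t enters
([mem_of_monomial_values]). A monomial b_j^t is itself a power. The other
exponents are all less than t, and they are separated by interpolation at t
points in each of the variables. The count #F >= t, rather than #F > t, is
enough since the pure powers are dealt with apart.

It remains to count the monomials of (X_0 + ... + X_m)^t in characteristic p
([size_msupp_sumX_exp]). Write t = d_0 + p t'. The power is then P * Q^p, with
P and Q the powers of exponents d_0 and t'. By Frobenius, Q^p only has
exponents divisible by p, whereas those of P are at most d_0 < p: by uniqueness
of Euclidean division no two terms of the product share an exponent, and the
numbers of monomials multiply ([size_msupp_mul_exp_pchar]). For an exponent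
d < p no multinomial coefficient vanishes, as d! is invertible, and all the
'C(m + d, d) monomials occur. *)

(** * Monomials of the powers of a sum of variables in characteristic p *)

Lemma mpoly_exp_pchar (F : fieldType) (p k : nat) (Q : {mpoly F[k]}) :
  p \in [pchar F] ->
  Q ^+ p = \sum_(q <- msupp Q) (Q@_q ^+ p) *: 'X_[q *+ p].
Proof.
move=> charF.
have charP : p \in [pchar {mpoly F[k]}] by rewrite pchar_lalg.
rewrite -(pFrobenius_autE charP) {1}[Q]mpolyE.
elim/big_rec2: _ => [|q y1 y2 _ <-]; first exact: pFrobenius_aut0.
rewrite pFrobenius_autD_comm; last exact: mulrC.
by rewrite !pFrobenius_autE exprZn mpolyXn.
Qed.

(** The exponent r + p q of a term of P * Q^p determines r and q, its remainder
and quotient by p, so no two terms merge. *)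
Lemma size_msupp_mul_exp_pchar (F : fieldType) (p k : nat)
    (P Q : {mpoly F[k]}) :
  p \in [pchar F] -> (forall m, m \in msupp P -> forall j, (m j < p)%N) ->
  size (msupp (P * Q ^+ p)) = (size (msupp P) * size (msupp Q))%N.
Proof.
move=> charF Plt; have p_gt0 : (0 < p)%N.
  by apply: prime_gt0; exact: pcharf_prime charF.
pose rem (m : 'X_{1..k}) : 'X_{1..k} := [multinom (m j %% p)%N | j < k].
pose quo (m : 'X_{1..k}) : 'X_{1..k} := [multinom (m j %/ p)%N | j < k].
pose mon (r q : 'X_{1..k}) := (r + q *+ p)%MM.
have monE r q j : mon r q j = (q j * p + r j)%N.
  by rewrite mnmDE mulmnE addnC.
have remK r q : r \in msupp P -> rem (mon r q) = r.
  move=> /Plt rlt; apply/mnmP => j.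
  by rewrite mnmE monE modnMDl modn_small.
have quoK r q : r \in msupp P -> quo (mon r q) = q.
  move=> /Plt rlt; apply/mnmP => j.
  by rewrite mnmE monE divnMDl // divn_small // addn0.
pose s := [seq mon r q | r <- msupp P, q <- msupp Q].
have -> : P * Q ^+ p = \sum_(m <- s) (P@_(rem m) * Q@_(quo m) ^+ p) *: 'X_[m].
  rewrite big_allpairs_dep {1}[P]mpolyE (mpoly_exp_pchar _ charF) mulr_suml.
  rewrite big_seq [RHS]big_seq; apply: eq_bigr => r rP.
  rewrite mulr_sumr; apply: eq_bigr => q _.
  by rewrite remK // quoK // -scalerAl -scalerAr scalerA mpolyXD.
rewrite (perm_size (msupp_sumX _ _)) ?size_allpairs //.
- apply: allpairs_uniq => // -[r1 q1] [r2 q2].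
  move=> /allpairsP[[r q] [/= P1 _ [e1 e2]]].
  move=> /allpairsP[[r' q'] [/= P2 _ [e3 e4]]].
  rewrite -{}e1 in P1; rewrite -{}e3 in P2 => {e2 e4} /= e.
  by congr pair;
    [rewrite -(remK _ q1 P1) e remK | rewrite -(quoK _ q1 P1) e quoK].
- move=> _ /allpairsP[[r q] [/= Pr Qq ->]].
  by rewrite remK // quoK // mulf_neq0 ?expf_neq0 // -mcoeff_msupp.
Qed.

Definition mpoly_sumX (F : fieldType) (k : nat) : {mpoly F[k]} :=
  \sum_(j < k) 'X_j.

Lemma mdeg_msupp_sumX_exp (F : fieldType) (k d : nat) (m : 'X_{1..k}) :
  m \in msupp (mpoly_sumX F k ^+ d) -> mdeg m = d.
Proof.
have hom : mpoly_sumX F k ^+ d \is d.-homog.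
  rewrite -[X in X.-homog]mul1n; apply: dhomogMn.
  by apply: rpred_sum => j _; rewrite dhomogX /= mdeg1.
by move/dhomogP: hom; apply.
Qed.

Lemma mderiv_sumX_exp (F : fieldType) (k d : nat) (j : 'I_k) :
  (mpoly_sumX F k ^+ d.+1)^`M(j) = mpoly_sumX F k ^+ d *+ d.+1.
Proof.
have dX : (mpoly_sumX F k)^`M(j) = 1.
  rewrite /mpoly_sumX raddf_sum (bigD1 j) //= big1 => [|i neq_ij].
    rewrite mderivX mnm1E eqxx -{1}[U_(j)%MM]add0m addmK mpolyX0.
    by rewrite scale1r addr0.
  by rewrite mderivX mnm1E (negbTE neq_ij) scale0r.
elim: d => [|d IHd]; first by rewrite expr1 dX.
by rewrite exprS mderivM IHd dX mul1r mulrnAr -exprS -mulrS.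
Qed.

(** This coefficient is a multinomial coefficient, a divisor of d!. The
induction goes through the partial derivatives, which relate it to a
coefficient of the power of exponent d - 1 by a factor d, invertible as
d < p. *)
Lemma mcoeff_sumX_exp_neq0 (F : fieldType) (p k d : nat) (m : 'X_{1..k}) :
  p \in [pchar F] -> (d < p)%N -> mdeg m = d ->
  (mpoly_sumX F k ^+ d)@_m != 0.
Proof.
move=> charF; elim: d m => [|d IHd] m d_lt.
  by move=> /eqP; rewrite mdeg_eq0 => /eqP->; rewrite mcoeff1 eqxx oner_eq0.
move=> deg_m; have [j mj] : exists j, m j != 0%N.
  apply/existsP; rewrite -negb_forall; apply: contraPN (deg_m) => /forallP m0.
  by rewrite mdegE big1 // => j _; apply/eqP.
have mE : m = (m - U_(j) + U_(j))%MM by rewrite submK // lep1mP.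
apply/eqP => c0.
have := mcoeff_mderiv j (mpoly_sumX F k ^+ d.+1) (m - U_(j))%MM.
rewrite -mE c0 mul0rn mderiv_sumX_exp mcoeffMn => /eqP.
rewrite -mulr_natr mulf_eq0 -(dvdn_pcharf charF) gtnNdvd // orbF.
apply/negP; apply: IHd; first exact: ltnW.
by apply/eqP; rewrite -eqSS -deg_m {2}mE mdegD mdeg1 addn1.
Qed.

Lemma size_msupp_sumX_exp_small (F : fieldType) (p m d : nat) :
  p \in [pchar F] -> (d < p)%N ->
  size (msupp (mpoly_sumX F m.+1 ^+ d)) = 'C(m + d, d).
Proof.
move=> charF d_lt; rewrite addnC -size_basis; apply: perm_size.
apply: uniq_perm; rewrite ?msupp_uniq ?uniq_basis // => e.
rewrite -basis_cover; apply/idP/eqP => [|deg_e].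
  exact: mdeg_msupp_sumX_exp.
by rewrite mcoeff_msupp (mcoeff_sumX_exp_neq0 charF).
Qed.

(** Form of Lucas' theorem: it counts the multinomial coefficients of a given
degree that are nonzero modulo p. *)
Lemma size_msupp_sumX_exp (F : fieldType) (p m n : nat) (d : nat -> nat) :
  p \in [pchar F] -> (forall i, (d i < p)%N) ->
  size (msupp (mpoly_sumX F m.+1 ^+ (\sum_(i < n) d i * p ^ i))) =
    (\prod_(i < n) 'C(m + d i, d i))%N.
Proof.
move=> charF; elim: n d => [|n IHn] d d_lt.
  by rewrite !big_ord0 expr0 msupp1.
rewrite !big_ord_recl /= expn0 muln1.
rewrite -(size_msupp_sumX_exp_small m charF (d_lt 0%N)).
rewrite -(IHn (fun i => d i.+1)) // -(size_msupp_mul_exp_pchar _ charF).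
  rewrite -exprM -exprD mulnC big_distrr /=.
  congr (size (msupp (_ ^+ (_ + _)))).
  by apply: eq_bigr => i _; rewrite /bump /= expnS mulnCA.
move=> e /mdeg_msupp_sumX_exp deg_e j; apply: leq_ltn_trans (d_lt 0%N).
by rewrite -deg_e mdegE (bigD1 j) //= leq_addr.
Qed.

(** * Orthogonality for a pairing *)

(** Pairing with a basis of W embeds U into a space of dimension \dim W. *)
Lemma dim_le_of_separating (F : fieldType) (A C : vectType F)
    (B : A -> C -> F^o) (U : {vspace A}) (W : {vspace C}) :
  (forall c, linear (B^~ c)) -> (forall a, linear (B a)) ->
  (forall u, u \in U -> (forall w, w \in W -> B u w = 0) -> u = 0) ->
  (\dim U <= \dim W)%N.
Proof.
move=> linBl linBr sepB.
pose f (a : A) : 'rV[F]_(\dim W) := \row_j B a (vbasis W)`_j.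
have lin_f : linear f by move=> c u v; apply/rowP => j; rewrite !mxE linBl.
pose fL : {linear A -> 'rV[F]_(\dim W)} :=
  HB.pack f (GRing.isLinear.Build F A 'rV[F]_(\dim W) _ f lin_f).
have kerf : (U :&: lker (linfun fL) = 0)%VS.
  apply/eqP; rewrite -subv0; apply/subvP => u.
  rewrite memv_cap memv_ker lfunE /= memv0 => /andP[uU /eqP/rowP fu0].
  apply/eqP; apply: sepB => // w wW.
  pose Bu : {linear C -> F^o} :=
    HB.pack (B u) (GRing.isLinear.Build F C F^o _ (B u) (linBr u)).
  rewrite (coord_vbasis wW) -[B u]/(Bu : C -> F^o) linear_sum big1 // => j _.
  by rewrite linearZ /=; have := fu0 j; rewrite !mxE => ->; rewrite scaler0.
rewrite -(limg_dim_eq kerf); apply: leq_trans (dimvS (subvf _)) _.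
by rewrite dimvf dim_matrix mul1r.
Qed.

(** B pairs W without kernel on either side with any complement of N, and
S with Y. Each of the two equalities of dimensions comes from two uses of
[dim_le_of_separating], one for each side. *)
Lemma dim_orthogonal (F : fieldType) (S Y : vectType F)
    (B : {bilinear S -> Y -> F^o}) (W : {vspace S}) (N : {vspace Y}) :
  nondegenerate_pairing B ->
  (forall y, y \in N <-> (forall w, w \in W -> B w y = 0)) ->
  (\dim N + \dim W = \dim {:S})%N.
Proof.
move=> [ndS ndY] NP.
have linl y : linear (B^~ y) by move=> c u v; rewrite linearPl.
have linr s : linear (B s) by move=> c u v; rewrite linearPr.
have dimSY : \dim {:S} = \dim {:Y}.
  apply/eqP; rewrite eqn_leq; apply/andP; split.
    apply: (dim_le_of_separating linl linr) => s _ s0; apply: ndS => y.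
    by apply: s0; exact: memvf.
  apply: (@dim_le_of_separating _ _ _ (fun y s => B s y)) => // y _ y0.
  by apply: ndY => s; apply: y0; exact: memvf.
have dimNC : (\dim N^C)%VS = \dim W.
  apply/eqP; rewrite eqn_leq; apply/andP; split.
    apply: (@dim_le_of_separating _ _ _ (fun y s => B s y)) => // y yNC y0.
    have : y \in (N :&: N^C)%VS by rewrite memv_cap yNC andbT; apply/NP.
    by rewrite capv_compl memv0 => /eqP.
  apply: (dim_le_of_separating linl linr) => w wW w0; apply: ndS => y.
  have : y \in (N + N^C)%VS by rewrite addv_complf memvf.
  case/memv_addP => y1 y1N [y2 y2N ->]; rewrite linearDr /= (w0 y2) // addr0.
  by move/NP: y1N; apply.
by rewrite -dimNC dimv_compl dimSY subnKC // dimvS ?subvf.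
Qed.

(** * Multilinear maps *)

Lemma ffun_upd_id (I : finType) (T : Type) (a : {ffun I -> T}) i :
  ffun_upd a i (a i) = a.
Proof. by apply/ffunP => j; rewrite ffunE; case: eqP => [->|]. Qed.

Lemma multilinear_sum (F : fieldType) (t : nat) (U W : lmodType F)
    (f : {ffun 'I_t -> U} -> W) (k : nat) (c : 'I_k -> F) (u : 'I_k -> U) a i :
  multilinear f ->
  f (ffun_upd a i (\sum_j c j *: u j)) = \sum_j c j *: f (ffun_upd a i (u j)).
Proof.
move=> mf; elim/big_rec2: _ => [|j y1 y2 _ <-]; last by rewrite mf.
apply: (addrI (f (ffun_upd a i 0))).
by rewrite addr0 -[X in X + _]scale1r -mf scale1r addr0.
Qed.

Lemma multilinear_eq0 (F : fieldType) (t : nat) (U W : lmodType F)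
    (f : {ffun 'I_t -> U} -> W) (a : {ffun 'I_t -> U}) i :
  multilinear f -> a i = 0 -> f a = 0.
Proof.
move=> mf ai0; rewrite -(ffun_upd_id a i) ai0.
(* The zero vector as an empty linear combination. *)
have := @multilinear_sum _ _ _ _ f 0 (fun=> 0) (fun=> 0) a i mf.
by rewrite !big_ord0.
Qed.

Lemma multilinear_eq_on_basis (F : fieldType) (t k : nat) (U : vectType F)
    (W : lmodType F) (b : k.-tuple U) (f g : {ffun 'I_t -> U} -> W) :
  basis_of fullv b -> multilinear f -> multilinear g ->
  (forall T : {ffun 'I_t -> 'I_k},
     f [ffun i => b`_(T i)] = g [ffun i => b`_(T i)]) ->
  f =1 g.
Proof.
move=> bP mf mg fgb.
(* The arguments of index at least n are basis vectors; n runs up to t. *)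
suff main n (a : {ffun _ -> U}) :
    (forall i : 'I_t, (n <= i)%N -> exists j : 'I_k, a i = b`_j) -> f a = g a.
  by move=> a; apply: (main t) => i; rewrite leqNgt ltn_ord.
elim: n a => [|n IHn] a ab.
  have [T TP] : exists T : {ffun 'I_t -> 'I_k}, forall i, a i = b`_(T i).
    have ab0 i : exists j : 'I_k, a i == b`_j.
      by have [j ->] := ab i isT; exists j.
    exists [ffun i => xchoose (ab0 i)] => i.
    by rewrite ffunE; apply/eqP; exact: (xchooseP (ab0 i)).
  suff -> : a = [ffun i => b`_(T i)] by exact: fgb.
  by apply/ffunP => i; rewrite ffunE.
have [tn|nt] := leqP t n.
  apply: IHn => i ni.
  by have := leq_trans (ltn_ord i) (leq_trans tn ni); rewrite ltnn.
rewrite -(ffun_upd_id a (Ordinal nt)) (coord_basis bP (memvf (a (Ordinal nt)))).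
rewrite !multilinear_sum //; apply: eq_bigr => j _; congr (_ *: _).
apply: IHn => i ni; rewrite ffunE; case: eqP => [_|neq]; first by exists j.
apply: ab; rewrite ltn_neqAle ni andbT; apply/eqP => e; apply: neq.
exact/val_inj.
Qed.

Lemma symmetric_map_perm_eq (t k : nat) (U W : Type)
    (f : {ffun 'I_t -> U} -> W) (b : 'I_k -> U) (T T' : t.-tuple 'I_k) :
  symmetric_map f -> perm_eq T T' ->
  f [ffun i => b (tnth T i)] = f [ffun i => b (tnth T' i)].
Proof.
move=> sf /tuple_permP[s Ts]; rewrite -[RHS](sf s); congr (f _).
by apply/ffunP => i; rewrite !ffunE (val_inj Ts : T = _) tnth_mktuple.
Qed.

Lemma perm_m2s_s2m (k : nat) (T : seq 'I_k) : perm_eq T (m2s (s2m T)).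
Proof.
apply/allP => j _ /=; apply/eqP.
by have /mnmP/(_ j) := s2mK (s2m T); rewrite !mnmE => ->.
Qed.

(** * Separating monomials by their values *)

(** The weights are the entries of the inverse of the Vandermonde matrix of
x. *)
Lemma interpolation_weights (F : fieldType) (t : nat) (x : t.-tuple F) :
  uniq x -> exists w : 'I_t -> 'I_t -> F,
    forall i l : 'I_t, \sum_j w l j * tnth x j ^+ i = (i == l)%:R.
Proof.
move=> x_uniq; pose M := Vandermonde t (\row_j tnth x j).
have unitM : M \in unitmx.
  rewrite unitmxE det_Vandermonde unitfE; apply/prodf_neq0 => i _.
  apply/prodf_neq0 => j lt_ij; rewrite !mxE subr_eq0 !(tnth_nth 0).
  by rewrite nth_uniq ?size_tuple // gtn_eqF.
exists (fun l j => invmx M j l) => i l.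
have /matrixP/(_ i l) := mulmxV unitM; rewrite !mxE => <-.
by apply: eq_bigr => j _; rewrite !mxE mulrC.
Qed.

Definition monomial_value (F : fieldType) (k : nat) (alpha : 'I_k -> F)
    (e : 'X_{1..k}) : F := \prod_j alpha j ^+ e j.

Lemma monomial_value_delta (F : fieldType) (k t : nat) (j : 'I_k)
    (e : 'X_{1..k}) : mdeg e = t ->
  monomial_value (fun i => (i == j)%:R : F) e = (e == (U_(j) *+ t)%MM)%:R.
Proof.
move=> deg_e; rewrite /monomial_value.
have [->|neq] := eqVneq; last first.
  have [i /andP[neq_ij ei]] : exists i, (i != j) && (e i != 0%N).
    apply/existsP; apply: contraNT neq => /existsPn e0.
    have e0' i : i != j -> e i = 0%N.
      by move=> neq_ij; have := e0 i; rewrite neq_ij negbK => /eqP.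
    apply/eqP/mnmP => i; rewrite mulmnE mnm1E -deg_e mdegE (bigD1 j) //=.
    rewrite big1 // addn0; have [<-|neq_ji] := eqVneq; first by rewrite mul1n.
    by rewrite e0' // eq_sym.
  by rewrite (bigD1 i) //= (negbTE neq_ij) expr0n (negbTE ei) mul0r.
rewrite big1 // => i _; rewrite mulmnE mnm1E eq_sym.
by case: eqP => _; rewrite ?mul0n ?expr0 ?expr1n.
Qed.

(** For G = 0 this is the linear independence, as functions on a field with at
least t elements, of the monomials of degree t. The bound is sharp, since
X^q Y - X Y^q vanishes everywhere on a field with q elements. Interpolation at
t points only sees exponents less than t, hence the separate treatment of the
pure powers. *)
Lemma mem_of_monomial_values (F : fieldType) (t k : nat) (x : t.-tuple F)
    (V : vectType F) (G : {vspace V}) (r : seq 'X_{1..k})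
    (y : 'X_{1..k} -> V) :
  uniq x -> uniq r -> (forall e, e \in r -> mdeg e = t) ->
  (forall alpha, \sum_(e <- r) monomial_value alpha e *: y e \in G) ->
  forall e, e \in r -> y e \in G.
Proof.
move=> x_uniq r_uniq deg_r valG.
(* A combination in G whose other terms are in G isolates the term e. *)
have select (c : 'X_{1..k} -> F) e : e \in r -> c e = 1 ->
    (forall e', e' \in r -> e' != e -> c e' *: y e' \in G) ->
    \sum_(e' <- r) c e' *: y e' \in G -> y e \in G.
  move=> er ce cG; rewrite (bigD1_seq e) //= ce scale1r rpredDr //.
  by rewrite big_seq_cond; apply: rpred_sum => e' /andP[]; exact: cG.
(* At the j-th unit vector only the power t of the j-th variable is nonzero. *)
have pure e j : e \in r -> (t <= e j)%N -> y e \in G.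
  move=> er tle; have eE : e = (U_(j) *+ t)%MM.
    have := deg_r e er; rewrite mdegE (bigD1 j) //= => deg_e.
    have rest0 : (\sum_(i < k | i != j) e i = 0)%N.
      by apply/eqP; rewrite -leqn0 -(leq_add2l (e j)) deg_e addn0.
    have ej : e j = t by rewrite -deg_e rest0 addn0.
    apply/mnmP => i; rewrite mulmnE mnm1E.
    have [<-|neq_ji] := eqVneq; first by rewrite mul1n.
    move/eqP: rest0; rewrite sum_nat_eq0 => /forallP/(_ i).
    by rewrite eq_sym neq_ji => /eqP.
  apply: (select _ e er _ _ (valG (fun i => (i == j)%:R))).
    by rewrite (monomial_value_delta _ _ (deg_r e er)) eE eqxx.
  move=> e' e'r neq; rewrite (monomial_value_delta _ _ (deg_r e' e'r)) -eE.
  by rewrite (negbTE neq) scale0r mem0v.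
have [w wP] := interpolation_weights x_uniq.
move=> e er.
have [/existsP[j]|/existsPn small] := boolP [exists j, (t <= e j)%N].
  exact: pure.
have e_lt j : (e j < t)%N by rewrite ltnNge small.
(* c e' is a combination of values of the monomial e' at points with
   coordinates in x; it is the indicator of e on the exponents less than t. *)
pose o j := Ordinal (e_lt j).
pose c (e' : 'X_{1..k}) := \prod_j \sum_i w (o j) i * tnth x i ^+ e' j.
apply: (select c e er).
- by rewrite /c big1 // => j _; rewrite (wP (o j)) eqxx.
- move=> e' e'r neq; have [/existsP[j tle]|/existsPn small'] :=
    boolP [exists j, (t <= e' j)%N]; first by rewrite rpredZ // (pure _ j).
  have e'_lt j : (e' j < t)%N by rewrite ltnNge small'.
  have [j neq_j] : exists j, e' j != e j.
    apply/existsP; apply: contraNT neq => /existsPn h.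
    by apply/eqP/mnmP => j; apply/eqP; rewrite -[_ == _]negbK h.
  rewrite /c (bigD1 j) //= (wP (Ordinal (e'_lt j))) -val_eqE /= (negbTE neq_j).
  by rewrite mul0r scale0r mem0v.
have -> : \sum_(e' <- r) c e' *: y e' =
    \sum_(h : {ffun 'I_k -> 'I_t}) (\prod_j w (o j) (h j)) *:
      \sum_(e' <- r) monomial_value (fun j => tnth x (h j)) e' *: y e'.
  under [RHS]eq_bigr do rewrite scaler_sumr.
  rewrite exchange_big; apply: eq_bigr => e' _ /=.
  rewrite /c bigA_distr_bigA scaler_suml; apply: eq_bigr => h _.
  by rewrite scalerA -big_split.
by apply: rpred_sum => h _; rewrite rpredZ.
Qed.

(** Substitution of alpha_j X_j for X_j in the power of the sum of the
variables. *)
Lemma scaled_sumX_exp (F : fieldType) (k t : nat) (alpha : 'I_k -> F) :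
  (\sum_(j < k) alpha j *: 'X_j) ^+ t =
    \sum_(e <- msupp (mpoly_sumX F k ^+ t))
      (monomial_value alpha e * (mpoly_sumX F k ^+ t)@_e) *: 'X_[e].
Proof.
pose lq := [tuple alpha j *: ('X_j : {mpoly F[k]}) | j < k].
have -> : \sum_(j < k) alpha j *: 'X_j = mpoly_sumX F k \mPo lq.
  rewrite raddf_sum; apply: eq_bigr => j _.
  by rewrite /= comp_mpolyXU -tnth_nth tnth_mktuple.
rewrite -rmorphXn /= comp_mpolyEX; apply: eq_bigr => e _.
rewrite mulrC -scalerA comp_mpolyX; congr (_ *: _).
rewrite [X in _ *: X]mpolyXE_id -scaler_prod; apply: eq_bigr => j _.
by rewrite tnth_mktuple exprZn.
Qed.

(** * Symmetric powers and homogeneous polynomials *)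

Section SymmetricPower.
Variables (F : fieldType) (t m : nat) (U S : vectType F).
Variables (mul : {ffun 'I_t -> U} -> S) (b : m.+1.-tuple U).
Hypotheses (symP : is_sym_power mul) (bP : basis_of fullv b).

Definition linear_form (u : U) : {mpoly F[m.+1]} :=
  \sum_(j < m.+1) coord b j u *: 'X_j.

Definition prod_linear_forms (a : {ffun 'I_t -> U}) : {mpoly F[m.+1]} :=
  \prod_(i < t) linear_form (a i).

Lemma linear_form_linear : linear linear_form.
Proof.
move=> c u v; rewrite /linear_form scaler_sumr -big_split.
by apply: eq_bigr => j _; rewrite /= linearP /= scalerDl scalerA.
Qed.

Lemma linear_form_basis (j : 'I_m.+1) : linear_form b`_j = 'X_j.
Proof.
rewrite /linear_form (bigD1 j) //= coord_free ?(basis_free bP) // eqxx scale1r.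
rewrite big1 ?addr0 // => i neq_ij.
by rewrite coord_free ?(basis_free bP) // eq_sym (negbTE neq_ij) scale0r.
Qed.

Lemma prod_linear_forms_multilinear : multilinear prod_linear_forms.
Proof.
move=> a i c u v.
have upd w : prod_linear_forms (ffun_upd a i w) =
             linear_form w * \prod_(j < t | j != i) linear_form (a j).
  rewrite /prod_linear_forms (bigD1 i) //= ffunE eqxx; congr (_ * _).
  by apply: eq_bigr => j neq_ji; rewrite ffunE (negbTE neq_ji).
by rewrite !upd linear_form_linear mulrDl -scalerAl.
Qed.

Lemma prod_linear_forms_symmetric : symmetric_map prod_linear_forms.
Proof.
move=> s a; rewrite /prod_linear_forms [RHS](reindex_inj (@perm_inj _ s)) /=.
by apply: eq_bigr => i _; rewrite ffunE.
Qed.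

(** The list [m2s e] enumerates the variables of e with multiplicity. It has
size t when e has degree t, the only case of interest, so that the default
value is not reached. *)
Definition monomial_product (e : 'X_{1..m.+1}) : S :=
  mul [ffun i : 'I_t => b`_(nth ord0 (m2s e) i)].

Lemma prod_linear_forms_basis (T : t.-tuple 'I_m.+1) :
  prod_linear_forms [ffun i => b`_(tnth T i)] = 'X_[s2m T].
Proof.
rewrite /prod_linear_forms (eq_bigr (fun i => 'X_(tnth T i))) => [|i _];
  last by rewrite ffunE linear_form_basis.
rewrite mprodXE; congr 'X_[_]; apply/mnmP => j; rewrite mnm_sumE mnmE.
rewrite -sum1_count big_tuple [RHS]big_mkcond.
by apply: eq_bigr => i _; rewrite mnm1E /=; case: eqP.
Qed.

Lemma mul_basis (T : t.-tuple 'I_m.+1) :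
  mul [ffun i => b`_(tnth T i)] = monomial_product (s2m T).
Proof.
have permT := perm_m2s_s2m T.
have sz : size (m2s (s2m T)) == t by rewrite -(perm_size permT) size_tuple.
have [_ symm _] := symP.
rewrite (symmetric_map_perm_eq (fun j : 'I__ => b`_j) symm (T' := Tuple sz)) //.
by congr mul; apply/ffunP => i; rewrite !ffunE (tnth_nth ord0).
Qed.

Let degree_t := [seq s2m T | T : t.-tuple 'I_m.+1 <- enum (basis m.+1 t)].

(** Inverse of the map from S to the homogeneous polynomials of degree t,
extended by zero on the other degrees so as to be linear on all polynomials. *)
Definition combine_monomials (p : {mpoly F[m.+1]}) : S :=
  \sum_(e <- degree_t) p@_e *: monomial_product e.

Lemma combine_monomials_linear : linear combine_monomials.
Proof.
move=> c p q; rewrite /combine_monomials scaler_sumr -big_split.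
by apply: eq_bigr => e _; rewrite /= mcoeffD mcoeffZ scalerDl scalerA.
Qed.

HB.instance Definition _ := GRing.isLinear.Build F {mpoly F[m.+1]} S _
  combine_monomials combine_monomials_linear.

Lemma combine_monomialsX e :
  mdeg e = t -> combine_monomials 'X_[e] = monomial_product e.
Proof.
move/eqP; rewrite basis_cover /combine_monomials => er.
rewrite (bigD1_seq e) ?uniq_basis //= mcoeffX eqxx scale1r big1 ?addr0 //.
by move=> e' neq; rewrite mcoeffX eq_sym (negbTE neq) scale0r.
Qed.

(** The universal property provides phi. The two sides of the cancellation
agree on products of basis vectors, hence on all products by multilinearity,
hence everywhere. *)
Lemma sym_power_mpoly :
  exists phi : {linear S -> {mpoly F[m.+1]}},
    (forall a, phi (mul a) = prod_linear_forms a) /\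
    cancel phi combine_monomials.
Proof.
have [multi symm univ] := symP.
have [phi [phiE _]] := univ _ _ prod_linear_forms_multilinear
  prod_linear_forms_symmetric.
exists phi; split=> // s.
have phiK a : combine_monomials (phi (mul a)) = mul a.
  rewrite phiE; move: a; apply: (multilinear_eq_on_basis bP
      (f := combine_monomials \o prod_linear_forms) (g := mul)) => //.
    by move=> a i c u v; rewrite /= prod_linear_forms_multilinear linearP.
  move=> f; pose T := [tuple f i | i < t].
  have -> : [ffun i => b`_(f i)] = [ffun i => b`_(tnth T i)].
    by apply/ffunP => i; rewrite !ffunE tnth_mktuple.
  rewrite /= prod_linear_forms_basis mul_basis combine_monomialsX //.
  by rewrite -size_m2s -(perm_size (perm_m2s_s2m T)) size_tuple.
(* Products span S: the universal property makes a linear map on S that fixes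
   all of them the identity. *)
have [chi [_ chiP]] := univ _ _ multi symm.
rewrite -[LHS]/((combine_monomials \o phi) s).
by rewrite (chiP (combine_monomials \o phi)) // -(chiP idfun).
Qed.

(** The images under phi are distinct monomials: the coefficient at e is a
linear functional that tells e from the others. *)
Lemma free_monomial_product (r : seq 'X_{1..m.+1}) :
  uniq r -> (forall e, e \in r -> mdeg e = t) ->
  free [seq monomial_product e | e <- r].
Proof.
move=> r_uniq deg_r; have [phi [phiE _]] := sym_power_mpoly.
have phi_mono e : mdeg e = t -> phi (monomial_product e) = 'X_[e].
  move=> /eqP; rewrite -size_m2s => sz.
  by rewrite -[e in LHS]s2mK -[m2s e]/(val (Tuple sz)) -mul_basis phiE
    prod_linear_forms_basis s2mK.
elim: r r_uniq deg_r => [|e r IHr] /=; first by rewrite nil_free.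
case/andP=> er r_uniq deg_er; have deg_r e' : e' \in r -> mdeg e' = t.
  by move=> e'r; apply: deg_er; rewrite inE e'r orbT.
rewrite free_cons IHr // andbT; apply/negP => mono_e.
pose f s : F^o := (phi s)@_e.
have f_lin : linear f by move=> c u v; rewrite /f linearP mcoeffD mcoeffZ.
pose fL : {linear S -> F^o} :=
  HB.pack f (GRing.isLinear.Build F S F^o _ f f_lin).
have /subvP/(_ _ mono_e) : (<<[seq monomial_product e | e <- r]>> <=
                            lker (linfun fL))%VS.
  apply/span_subvP => _ /mapP[e' e'r ->]; rewrite memv_ker lfunE /= /f.
  rewrite phi_mono ?deg_r // mcoeffX.
  by case: (e' =P e) e'r er => [-> ->|].
rewrite memv_ker lfunE /= /f phi_mono ?deg_er ?inE ?eqxx //.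
by rewrite mcoeffX eqxx oner_eq0.
Qed.

Lemma dim_sym_power : \dim {:S} = 'C(m + t, t).
Proof.
have [phi [_ phiK]] := sym_power_mpoly.
have deg_r e : e \in degree_t -> mdeg e = t by rewrite -basis_cover => /eqP.
have := free_monomial_product (uniq_basis _ _) deg_r.
rewrite /free size_map size_basis addnC => /eqP <-; congr (\dim _).
apply/eqP; rewrite eqEsubv subvf andbT; apply/subvP => s _.
rewrite -(phiK s) /combine_monomials big_seq; apply: rpred_sum => e er.
by apply: rpredZ; apply: memv_span; exact: map_f.
Qed.

(** Multinomial theorem in S. *)
Lemma mul_diag (u : U) :
  mul [ffun _ => u] = \sum_(e <- msupp (mpoly_sumX F m.+1 ^+ t))
    monomial_value (fun j => coord b j u) e *:
      ((mpoly_sumX F m.+1 ^+ t)@_e *: monomial_product e).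
Proof.
have [phi [phiE phiK]] := sym_power_mpoly.
rewrite -[LHS]phiK phiE /prod_linear_forms.
rewrite (eq_bigr (fun=> linear_form u)) => [|i _]; last by rewrite ffunE.
rewrite prodr_const card_ord /linear_form scaled_sumX_exp linear_sum.
rewrite big_seq [RHS]big_seq; apply: eq_bigr => e er /=.
by rewrite linearZ /= combine_monomialsX ?(mdeg_msupp_sumX_exp er) // scalerA.
Qed.

Lemma mul_diag_in_span (u : U) :
  mul [ffun _ => u] \in
    <<[seq monomial_product e | e <- msupp (mpoly_sumX F m.+1 ^+ t)]>>%VS.
Proof.
rewrite mul_diag big_seq; apply: rpred_sum => e er.
by rewrite !rpredZ // memv_span // map_f.
Qed.

Lemma span_of_mul_diag (G : {vspace S}) :
  card_ge F t -> (forall u, mul [ffun _ => u] \in G) ->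
  (<<[seq monomial_product e | e <- msupp (mpoly_sumX F m.+1 ^+ t)]>> <= G)%VS.
Proof.
move=> [x x_uniq] diagG; apply/span_subvP => _ /mapP[e er ->].
suff : (mpoly_sumX F m.+1 ^+ t)@_e *: monomial_product e \in G.
  move/(rpredZ ((mpoly_sumX F m.+1 ^+ t)@_e)^-1); rewrite scalerA mulVf.
    by rewrite scale1r.
  by rewrite -mcoeff_msupp.
apply: (mem_of_monomial_values
  (y := fun e => (mpoly_sumX F m.+1 ^+ t)@_e *: monomial_product e)
  x_uniq (msupp_uniq _) _ _ er) => [e' e'r|alpha].
  exact: mdeg_msupp_sumX_exp e'r.
have valE e' :
    monomial_value (fun j => coord b j (\sum_j alpha j *: b`_j)) e' =
      monomial_value alpha e'.
  by apply: eq_bigr => j _; rewrite coord_sum_free ?(basis_free bP).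
have := diagG (\sum_j alpha j *: b`_j); rewrite mul_diag.
by under eq_bigr do rewrite valE.
Qed.

End SymmetricPower.

(** * The nucleus *)

Lemma dim_dual (F : fieldType) (X : vectType F) :
  \dim {:dual X} = \dim {:X}.
Proof. by rewrite !dimvf [LHS]muln1. Qed.

(** The zero form, which defines no hyperplane, may be included: its power
vanishes when t > 0. *)
Lemma mem_nucleus (F : fieldType) (X : vectType F) (t : nat)
    (V : veronese X t) (y : ver_space V) : (0 < t)%N ->
  y \in nucleus V <-> (forall a, ver_pair V (sym_pow V a) y = 0).
Proof.
move=> t_gt0; split=> [/bigcapvP yN a|y0].
  have [->|nz_a] := eqVneq a 0.
    have [multi _ _] := ver_symP V.
    rewrite /sym_pow (multilinear_eq0 (i := Ordinal t_gt0) multi) ?ffunE //.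
    by rewrite linear0l.
  apply/eqP; rewrite -mem_osculating_hyperplane; apply: yN.
  by exists (veronese_image (lker a)), a.
apply/bigcapvP => H [Z [a [_ -> _]]].
by rewrite mem_osculating_hyperplane y0.
Qed.

Theorem theorem2 (F : fieldType) (p m t : nat)
    (charF : p \in [pchar F])
    (m_ge1 : (1 <= m)%N) (t_ge2 : (2 <= t)%N)
    (* base p digits of t, all those of index at least n being zero *)
    (n : nat) (d : nat -> nat)
    (d_lt : forall i, (d i < p)%N)
    (d_fin : forall i, (n <= i)%N -> d i = 0%N)
    (t_digits : t = (\sum_(i < n) d i * p ^ i)%N)
    (cardF : card_ge F t)
    (X : vectType F) (dimX : \dim {:X} = m.+1)
    (V : veronese X t) :
  projdim (nucleus V) =
    ('C(m + t, t))%:Z - (\prod_(i < n) 'C(m + d i, d i))%N%:Z - 1.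
Proof.
have [b bP] : exists b : m.+1.-tuple (dual X), basis_of fullv b.
  rewrite -dimX -dim_dual; exists (vbasis fullv); exact: vbasisP.
have symP := ver_symP V.
pose P := mpoly_sumX F m.+1 ^+ t.
pose W := <<[seq monomial_product (ver_mul V) b e | e <- msupp P]>>%VS.
have dimW : \dim W = (\prod_(i < n) 'C(m + d i, d i))%N.
  rewrite -(size_msupp_sumX_exp m n charF d_lt) -t_digits.
  have := free_monomial_product symP bP (msupp_uniq P).
  rewrite /free size_map => /(_ _)/eqP -> // e.
  exact: mdeg_msupp_sumX_exp.
have NP y : y \in nucleus V <-> (forall w, w \in W -> ver_pair V w y = 0).
  rewrite mem_nucleus ?(ltnW t_ge2) //; split=> [y0 w wW|yW a]; last first.
    by apply: yW; exact: mul_diag_in_span.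
  pose f s : F^o := ver_pair V s y.
  have f_lin : linear f by move=> c u v; rewrite /f linearPl.
  pose fL : {linear ver_sym V -> F^o} :=
    HB.pack f (GRing.isLinear.Build F (ver_sym V) F^o _ f f_lin).
  have /subvP/(_ _ wW) : (W <= lker (linfun fL))%VS.
    apply: span_of_mul_diag => // a.
    by rewrite memv_ker lfunE /= /f; apply/eqP; exact: y0.
  by rewrite memv_ker lfunE /= => /eqP.
have := dim_orthogonal (ver_pairP V) NP.
rewrite (dim_sym_power symP bP) dimW => <-.
by rewrite /projdim PoszD addrK.
Qed.
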